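(* Let $X$ be a compact metric $Z_2$-space with $\operatorname{ind}X=n$, covered by closed inessential invariant subsets $U_1,\dots,U_N$. Then $N\ge n+1$, and some $n+1$ of the sets $U_i$ have a common point.
   Context: $Z_2=\{1,\sigma\}$ acts continuously on $X$. $\operatorname{ind}Y$ for a $Z_2$-space $Y$ is the largest $n$ such that $w^n\ne0$ in $H^*_{Z_2}(Y;Z_2)=H^*(Y\times_{Z_2}EZ_2;Z_2)$ (Čech cohomology), with $w\in H^1$ the pullback of the generator of $H^*(\mathbb RP^\infty;Z_2)=Z_2[w]$ ($\infty$ if no largest). An invariant subset $U\subseteq X$ (i.e. $\sigma(U)=U$) is inessential if $\operatorname{ind}U=0$. *)

(* Defs.v *)
From HB Require Import structures.
From mathcomp Require Import all_boot all_order all_algebra.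
From mathcomp Require Import generic_quotient.
From mathcomp Require Import all_classical all_reals.
From mathcomp Require Import topology num_topology normedtype.

Set Implicit Arguments.
Unset Strict Implicit.
Unset Printing Implicit Defensive.

Import Order.TTheory GRing.Theory Num.Theory.
Import numFieldNormedType.Exports.

Local Open Scope classical_set_scope.
Local Open Scope ring_scope.

Record open_cover (T : topologicalType) := OpenCover {
  cidx : Type;
  cset :> cidx -> set T;
  cset_open : forall i, open (cset i);
  cset_cover : forall x, exists i, cset i x }.

Section Nerve.
Variables (T : topologicalType) (I : Type) (U : I -> set T).

(* The n-simplices of the nerve are ordered, repetitions being allowed. *)
Definition nerve (n : nat) : set (seq I) :=
  [set s | size s = n.+1 /\ \big[setI/setT]_(i <- s) U i !=set0].

Definition face (k : nat) (s : seq I) : seq I := take k s ++ drop k.+1 s.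

(* A cochain of degree n is a function on sequences, only the values of which
   on [nerve n] are relevant.  No signs, since 1 = -1 in 'F_2. *)
Definition coboundary (c : seq I -> 'F_2) (s : seq I) : 'F_2 :=
  \sum_(k < size s) c (face k s).

Definition cocycle (n : nat) (c : seq I -> 'F_2) : Prop :=
  forall s, nerve n.+1 s -> coboundary c s = 0.

(* There are no cochains of degree -1: the cohomology is not reduced. *)
Definition is_coboundary (n : nat) (c : seq I -> 'F_2) : Prop :=
  if n is m.+1 then
    exists b : seq I -> 'F_2, forall s, nerve m.+1 s -> c s = coboundary b s
  else forall s, nerve 0 s -> c s = 0.

(* Alexander-Whitney: front p-face times back face. *)
Definition cup (p : nat) (c d : seq I -> 'F_2) (s : seq I) : 'F_2 :=
  c (take p.+1 s) * d (drop p s).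

Fixpoint cup_pow (c : seq I -> 'F_2) (n : nat) : seq I -> 'F_2 :=
  if n is m.+1 then cup 1 c (cup_pow c m) else fun=> 1.

Lemma take_face_le m k s : (m <= k)%N -> (k <= size s)%N ->
  take m (face k s) = take m s.
Proof.
by move=> mk ks; rewrite /face takel_cat ?size_takel// take_takel.
Qed.

Lemma take_face_gt m k s : (k < m)%N -> (k <= size s)%N ->
  take m (face k s) = face k (take m.+1 s).
Proof.
move=> km ks; rewrite /face take_cat size_takel// ltnNge (ltnW km)/=.
rewrite take_takel ?(leq_trans (ltnW km))// take_drop.
by rewrite addnS subnK// ltnW.
Qed.

Lemma drop_face_ge p k s : (k <= p)%N -> (k <= size s)%N ->
  drop p (face k s) = drop p.+1 s.
Proof.
move=> kp ks; rewrite /face drop_cat size_takel// ltnNge kp/= drop_drop.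
by rewrite addnS subnK.
Qed.

Lemma drop_face_add p j s : (p + j <= size s)%N ->
  drop p (face (p + j) s) = face j (drop p s).
Proof.
move=> ks; rewrite /face take_drop drop_drop addSn (addnC j p).
rewrite drop_cat size_takel//; case: ltnP => // pj.
rewrite (_ : p - (p + j) = 0)%N ?drop0; last first.
  by apply/eqP; rewrite subn_eq0 leq_addr.
by rewrite [drop p _]drop_oversize ?size_takel.
Qed.

Lemma coboundary_cup (p q : nat) (c d : seq I -> 'F_2) (s : seq I) :
  size s = (p + q).+2 ->
  coboundary (cup p c d) s =
  cup p.+1 (coboundary c) d s + cup p c (coboundary d) s.
Proof.
move=> sz; rewrite /coboundary /cup.
have take_sz : size (take p.+2 s) = p.+2 by rewrite size_takel// sz !ltnS leq_addr.
have drop_sz : size (drop p s) = q.+2 by rewrite size_drop sz -!addnS addKn.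
rewrite take_sz drop_sz sz.
pose x := c (take p.+1 s) * d (drop p.+1 s).
pose A := \sum_(0 <= k < p.+1) c (face k (take p.+2 s)) * d (drop p.+1 s).
pose B := \sum_(1 <= k < q.+2) c (take p.+1 s) * d (face k (drop p s)).
have -> : \sum_(k < (p + q).+2) c (take p.+1 (face k s)) * d (drop p (face k s))
    = A + B.
  rewrite -(big_mkord xpredT (fun k => c (take p.+1 (face k s)) *
                                        d (drop p (face k s)))).
  rewrite (@big_cat_nat _ _ _ p.+1)//= ?ltnS ?leqW ?leq_addr//.
  congr (_ + _).
    apply: eq_big_nat => k /andP[_ kp].
    have ks : (k <= size s)%N.
      by rewrite sz (leq_trans (ltnW kp))// ltnW// !ltnS leq_addr.
    by rewrite take_face_gt// drop_face_ge.
  rewrite -{1}[p.+1]add1n big_addn.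
  rewrite (_ : (p + q).+2 - p = q.+2)%N; last by rewrite -!addnS addKn.
  apply: eq_big_nat => k /andP[k0 kq]; rewrite (addnC k).
  have ks : (p + k <= size s)%N by rewrite sz -!addnS leq_add2l ltnW.
  by rewrite take_face_le ?drop_face_add// -addn1 leq_add2l.
have -> : (\sum_(k < p.+2) c (face k (take p.+2 s))) * d (drop p.+1 s) = A + x.
  rewrite big_distrl/= -(big_mkord xpredT (fun k => c (face k (take p.+2 s)) *
    d (drop p.+1 s))) big_nat_recr//=; congr (_ + c _ * _).
  rewrite /face drop_oversize ?cats0 ?take_sz//.
  by rewrite take_takel.
have -> : c (take p.+1 s) * (\sum_(k < q.+2) d (face k (drop p s))) = x + B.
  rewrite big_distrr/= -(big_mkord xpredT (fun k => c (take p.+1 s) *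
    d (face k (drop p s)))) big_nat_recl//=; congr (_ + _).
    by rewrite /face take0 drop_drop add1n.
  by rewrite /B big_add1.
have xx : x + x = 0 by rewrite addrr_pchar2// pchar_Fp.
by rewrite addrACA addrA -[A + x + x]addrA xx addr0.
Qed.

Lemma sub_nerve (m n : nat) (s t : seq I) :
  nerve m s -> (forall x, (\big[setI/setT]_(i <- s) U i) x ->
                          (\big[setI/setT]_(i <- t) U i) x) ->
  size t = n.+1 -> nerve n t.
Proof. by move=> [_ [x sx]] st tn; split => //; exists x; exact: st. Qed.

Lemma nerve_take (n p : nat) (s : seq I) :
  (p <= n)%N -> nerve n s -> nerve p (take p.+1 s).
Proof.
move=> pn ns; apply: (sub_nerve ns); last by case: ns => sz _; rewrite size_takel ?sz.
by move=> x; rewrite -{1}(cat_take_drop p.+1 s) big_cat => -[].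
Qed.

Lemma nerve_drop (p q : nat) (s : seq I) : nerve (p + q) s -> nerve q (drop p s).
Proof.
move=> ns; apply: (sub_nerve ns).
  by move=> x; rewrite -{1}(cat_take_drop p s) big_cat => -[].
by case: ns => sz _; rewrite size_drop sz -addnS addKn.
Qed.

Lemma cocycle_cup (p q : nat) (c d : seq I -> 'F_2) :
  cocycle p c -> cocycle q d -> cocycle (p + q) (cup p c d).
Proof.
move=> pc qd s ns; have [sz _] := ns; rewrite (coboundary_cup _ _ sz) /cup.
rewrite pc ?mul0r ?add0r; last first.
  by apply: (nerve_take _ ns); rewrite ltnS leq_addr.
by rewrite qd ?mulr0//; apply: nerve_drop; rewrite addnS.
Qed.

Lemma cocycle_cup_pow (c : seq I -> 'F_2) (n : nat) :
  cocycle 1 c -> cocycle n (cup_pow c n).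
Proof.
move=> c1; elim: n => [s [sz _]|n IH]; last exact: (@cocycle_cup 1 n _ _ c1 IH).
rewrite /coboundary sz !big_ord_recl big_ord0 addr0.
by rewrite addrr_pchar2// pchar_Fp.
Qed.

End Nerve.

(* Cech cohomology with coefficients in Z/2 is the direct limit, over all open
   covers ordered by refinement, of the cohomologies of the nerves.  We work with
   representatives: an element of the limit is given by a cocycle on the nerve of
   some cover. *)
Record cech_class (T : topologicalType) (n : nat) := CechClass {
  cech_cover : open_cover T;
  cech_cochain : seq (cidx cech_cover) -> 'F_2;
  cech_cocycle : cocycle cech_cover n cech_cochain }.

Definition refinement (T : topologicalType) (U V : open_cover T)
    (tau : cidx V -> cidx U) : Prop :=
  forall j, V j `<=` U (tau j).

(* An element of a direct limit is zero iff it becomes zero at a later stage.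
   All refinement maps U <- V induce the same map in cohomology. *)
Definition cech_zero (T : topologicalType) (n : nat) (a : cech_class T n) : Prop :=
  exists (V : open_cover T) (tau : cidx V -> cidx (cech_cover a)),
    refinement tau /\
    is_coboundary V n (fun s => @cech_cochain T n a (map tau s)).

Definition cech_pow (T : topologicalType) (a : cech_class T 1) (n : nat) :
    cech_class T n :=
  @CechClass T n (cech_cover a) _ (cocycle_cup_pow (@cech_cocycle T 1 a)).

Section Pullback.
Variables (S T : topologicalType) (f : S -> T).
Hypothesis cf : continuous f.

Lemma preimage_cover_open (U : open_cover T) i : open (f @^-1` U i).
Proof. by move/continuousP: cf; apply; exact: cset_open. Qed.

Lemma preimage_cover_cover (U : open_cover T) x : exists i, (f @^-1` U i) x.
Proof. exact: cset_cover. Qed.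

Definition preimage_cover (U : open_cover T) : open_cover S :=
  OpenCover (@preimage_cover_open U) (preimage_cover_cover U).

Lemma nerve_preimage (U : open_cover T) n s :
  nerve (preimage_cover U) n s -> nerve U n s.
Proof.
move=> [sz [x Ux]]; split => //; exists (f x); move: Ux {sz}.
by elim: s => [|i s IH]; rewrite ?big_nil ?big_cons// => -[? /IH].
Qed.

Lemma cocycle_preimage (U : open_cover T) n c :
  cocycle U n c -> cocycle (preimage_cover U) n c.
Proof. by move=> nc s /nerve_preimage; exact: nc. Qed.

Definition cech_pullback (n : nat) (a : cech_class T n) : cech_class S n :=
  @CechClass S n (preimage_cover (cech_cover a)) _
    (cocycle_preimage (@cech_cocycle T n a)).

End Pullback.

Record Z2space := MkZ2space {
  z2_space :> topologicalType;
  z2_act : z2_space -> z2_space;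
  z2_act_continuous : continuous z2_act;
  z2_actK : involutive z2_act }.

Section Orbits.
Local Open Scope quotient_scope.
Variable Y : Z2space.

Definition same_orbit (x y : Y) : bool := (x == y) || (z2_act x == y).

Lemma same_orbit_refl : reflexive same_orbit.
Proof. by move=> x; rewrite /same_orbit eqxx. Qed.

Lemma same_orbit_sym : symmetric same_orbit.
Proof.
move=> x y; rewrite /same_orbit [x == y]eq_sym; congr (_ || _).
by apply/eqP/eqP => <-; rewrite z2_actK.
Qed.

Lemma same_orbit_trans : transitive same_orbit.
Proof.
rewrite /same_orbit => y x z /orP[]/eqP <- // /orP[]/eqP <-.
  by rewrite eqxx orbT.
by rewrite z2_actK eqxx.
Qed.

Definition orbit_equiv :=
  EquivRel same_orbit same_orbit_refl same_orbit_sym same_orbit_trans.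

Definition orbit_space : Type := {eq_quot orbit_equiv}.

HB.instance Definition _ :=
  Topological.copy orbit_space (quotient_topology {eq_quot orbit_equiv}).
HB.instance Definition _ := Quotient.on orbit_space.

End Orbits.

Section SubZ2space.
Variables (Y : Z2space) (U : set Y).

Definition z2_invariant : Prop := [set z2_act x | x in U] = U.

Hypothesis invU : z2_invariant.

Lemma sub_act_proof (x : U) : z2_act (set_val x) \in U.
Proof.
by have Ux := set_valP x; rewrite inE -[X in X _]invU; exists (set_val x).
Qed.

Definition sub_act (x : U) : U := SigSub (sub_act_proof x).

Lemma sub_act_continuous : continuous sub_act.
Proof.
apply: continuous_comp_initial => x.
rewrite (_ : set_val \o sub_act = @z2_act Y \o set_val)//.
apply: continuous_comp; last exact: z2_act_continuous.
exact: (@initial_continuous U Y set_val).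
Qed.

Lemma sub_actK : involutive sub_act.
Proof. by move=> x; apply/val_inj; exact: z2_actK. Qed.

Definition subZ2space : Z2space := MkZ2space sub_act_continuous sub_actK.

End SubZ2space.

Section ProdZ2space.
Variables Y Y' : Z2space.

Definition prod_act (x : Y * Y') : Y * Y' := (z2_act x.1, z2_act x.2).

Lemma prod_act_continuous : continuous prod_act.
Proof.
move=> x; apply: cvg_pair => /=.
  by apply: continuous_comp; [exact: cvg_fst|exact: z2_act_continuous].
by apply: continuous_comp; [exact: cvg_snd|exact: z2_act_continuous].
Qed.

Lemma prod_actK : involutive prod_act.
Proof. by move=> [x y]; rewrite /prod_act/= !z2_actK. Qed.

Definition prodZ2space : Z2space := MkZ2space prod_act_continuous prod_actK.

End ProdZ2space.

Section OrbitMap.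
Variables (Y Y' : Z2space) (f : Y -> Y').
Hypotheses (cf : continuous f) (ef : {morph f : x / z2_act x}).

Definition orbit_map (q : orbit_space Y) : orbit_space Y' :=
  (\pi_(orbit_space Y') (f (repr q)))%qT.

Lemma orbit_map_continuous : continuous orbit_map.
Proof.
apply: repr_comp_continuous (_ \o f) _ _ => [x|x y].
  by apply: continuous_comp; [exact: cf|exact: pi_continuous].
move=> /eqP/eqmodP xy; apply/eqP/eqmodP; move: xy.
by case/predU1P => [->|/eqP <-]; rewrite /= /same_orbit ?eqxx// -ef eqxx orbT.
Qed.

End OrbitMap.

Section Universal.
Variable R : realType.

(* The model of E Z/2 is S^oo, the unit sphere of the finitely supported real
   sequences, with the antipodal action.  On this sphere the topology of
   pointwise convergence coincides with that of the l^2-norm, and up to radial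
   rescaling this is Milnor's infinite join of copies of Z/2. *)
Definition sphere_inf : set {ptws nat -> R} :=
  [set x | exists m, (forall k, (m <= k)%N -> x k = 0) /\
                     \sum_(k < m) x k ^+ 2 = 1].

Lemma antipode_proof (x : sphere_inf) : (fun k => - (set_val x k)) \in sphere_inf.
Proof.
have [m [xm x1]] := set_valP x; rewrite inE; exists m; split.
  by move=> k /xm xk; apply/eqP; rewrite oppr_eq0; apply/eqP.
by rewrite -x1; apply: eq_bigr => k _; rewrite sqrrN.
Qed.

Definition antipode (x : sphere_inf) : sphere_inf := SigSub (antipode_proof x).

Lemma coord_continuous k : continuous (fun x : sphere_inf => set_val x k : R).
Proof.
move=> x.
have sx : (set_val : sphere_inf -> {ptws nat -> R}) @ x --> set_val x.
  exact: (@initial_continuous sphere_inf {ptws nat -> R} set_val).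
have P := @cvg_comp _ _ _ _ (fun h : nat -> R => h k) _ _ _ sx
  (@proj_continuous nat (fun=> R) k (set_val x)).
by apply P.
Qed.

Lemma antipode_continuous : continuous antipode.
Proof.
apply: continuous_comp_initial => x.
have FF : Filter ((set_val \o antipode) @ nbhs x) by exact: fmap_filter.
apply/cvg_sup => k A [_ [[W oW <-] /= Wx] WA].
apply: filterS WA _.
have cN : (fun y : R => - y) @ (set_val x k) --> - set_val x k.
  exact: opp_continuous.
have cx : (fun y : sphere_inf => set_val y k) @ x --> set_val x k.
  exact: coord_continuous.
have P := cvg_comp _ _ cx cN _ (open_nbhs_nbhs (conj oW Wx)).
by apply P.
Qed.

Lemma antipodeK : involutive antipode.
Proof.
by move=> x; apply/val_inj/funext => k /=; rewrite opprK.
Qed.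

Definition EZ2 : Z2space := MkZ2space antipode_continuous antipodeK.

Definition RPinf : topologicalType := orbit_space EZ2.

Definition Borel (Y : Z2space) : topologicalType := orbit_space (prodZ2space Y EZ2).

Definition Borel_proj (Y : Z2space) : Borel Y -> RPinf :=
  @orbit_map (prodZ2space Y EZ2) EZ2 snd.

Lemma Borel_proj_continuous (Y : Z2space) : continuous (@Borel_proj Y).
Proof.
by apply: orbit_map_continuous => // x; exact: cvg_snd.
Qed.

(* H^1(RP^oo; Z/2) = Z/2: its generator is its nonzero class. *)
Definition is_generator (w : cech_class RPinf 1) : Prop := ~ cech_zero w.

Variables (w : cech_class RPinf 1) (Y : Z2space).

Definition w_pow (n : nat) : cech_class (Borel Y) n :=
  cech_pow (cech_pullback (@Borel_proj_continuous Y) w) n.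

Definition is_index (n : nat) : Prop :=
  ~ cech_zero (w_pow n) /\ forall m, ~ cech_zero (w_pow m) -> (m <= n)%N.

(* [None] stands for infinity; it is also the value for an empty [Y]. *)
Definition ind : option nat :=
  if pselect (exists n, is_index n) is left h then Some (projT1 (cid h)) else None.

End Universal.

Lemma indP (R : realType) (w : cech_class (RPinf R) 1) (Y : Z2space) (n : nat) :
  ind w Y = Some n <-> is_index w Y n.
Proof.
rewrite /ind; case: pselect => [h|nh]; last by split => // wn; case: nh; exists n.
case: cid => k [wk kmax] /=; split => [[<-]//|[wn nmax]]; congr Some.
by apply/eqP; rewrite eqn_leq nmax// kmax.
Qed.

Definition inessential (R : realType) (w : cech_class (RPinf R) 1) (Y : Z2space)
    (U : set Y) : Prop :=
  exists invU : z2_invariant U, ind w (subZ2space invU) = Some 0%N.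

(* Main.v *)
(* If x lies in U_i, the map S^oo -> Borel(U_i) -> RP^oo sending z to the class
   of (x, z) is the double cover, so w becomes trivial on S^oo.  Since S^oo is
   connected and w is nonzero, this trivialization g is odd; comparing it with the
   trivializations of w over Borel(U_i) gives a continuous odd map U_i -> Z/2, and
   its two fibres are separated by an anti-invariant real function u_i on X which
   does not vanish on U_i.

   Suppose no n + 1 of the U_i meet.  Let d_i be the invariant distance to U_i.
   For 0 < |T| <= n, let O_T be the open set where d_i < d_j for i in T, j not in T,
   and u_i <> 0 for i in T.  These sets cover X (take T = {i | x in U_i}), and sets
   with the same |T| are disjoint, so that X is a union of n invariant open sets
   carrying odd maps.  As for the Lusternik-Schnirelmann category, w^n is then a
   product of n cocycles, the k-th one vanishing over the k-th set; hence w^n = 0,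
   which contradicts ind X = n. *)

Require Import Defs.
From mathcomp Require Import all_boot all_order all_algebra.
From mathcomp Require Import generic_quotient.
From mathcomp Require Import all_classical all_reals.
From mathcomp Require Import topology num_topology normedtype.
From mathcomp Require Import ring.

Set Implicit Arguments.
Unset Strict Implicit.
Unset Printing Implicit Defensive.

Import Order.TTheory GRing.Theory Num.Theory.
Import numFieldNormedType.Exports.

Local Open Scope classical_set_scope.
Local Open Scope ring_scope.

(** * Cochains modulo 2 *)

Lemma F2_addxx (x : 'F_2) : x + x = 0.
Proof. by rewrite addrr_pchar2// pchar_Fp. Qed.

Lemma F2_add_eq0 (x y : 'F_2) : x + y = 0 -> x = y.
Proof.
by move=> xy; rewrite -[x]addr0 -(F2_addxx y) addrA xy add0r.
Qed.

Lemma F2_eq1 (x : 'F_2) : x != 0 -> x = 1.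
Proof. by case: x => [[|[|//]] ?] // _; exact: val_inj. Qed.

Lemma coboundary_pair (I : Type) (b : seq I -> 'F_2) i j :
  coboundary b [:: i; j] = b [:: j] + b [:: i].
Proof. by rewrite /coboundary /= !big_ord_recl big_ord0 addr0. Qed.

Lemma coboundary_triple (I : Type) (c : seq I -> 'F_2) i j k :
  coboundary c [:: i; j; k] = c [:: j; k] + c [:: i; k] + c [:: i; j].
Proof. by rewrite /coboundary /= !big_ord_recl big_ord0 addr0 addrA. Qed.

Lemma size3P (I : Type) (s : seq I) : size s = 3%N ->
  exists i j k, s = [:: i; j; k].
Proof. by case: s => [|i [|j [|k [|]]]]//= _; exists i, j, k. Qed.

Lemma cocycle_triple (T : topologicalType) (I : Type) (U : I -> set T) c x i j k :
  cocycle U 1 c -> U i x -> U j x -> U k x ->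
  c [:: j; k] + c [:: i; k] + c [:: i; j] = 0.
Proof.
move=> cc Ui Uj Uk; rewrite -coboundary_triple; apply: cc; split => //.
by exists x; rewrite !big_cons big_nil.
Qed.

Lemma cocycle_add (T : topologicalType) (I : Type) (U : I -> set T) n c d :
  cocycle U n c -> cocycle U n d -> cocycle U n (fun s => c s + d s).
Proof.
by move=> cc cd s ns; rewrite /coboundary big_split/= [X in X + _]cc// [X in _ + X]cd// addr0.
Qed.

Lemma cocycle_coboundary0 (T : topologicalType) (I : Type) (U : I -> set T) b :
  cocycle U 1 (coboundary b).
Proof.
move=> s [/size3P[i [j [k ->]]] _].
rewrite coboundary_triple !coboundary_pair.
have <- := F2_addxx (b [:: i] + b [:: j] + b [:: k]).
by ring.
Qed.

(* The product of the classes [c + delta (b k)], all cohomologous to [c]. *)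
Fixpoint twisted_pow (I : Type) (c : seq I -> 'F_2) (b : nat -> seq I -> 'F_2)
    (n : nat) : seq I -> 'F_2 :=
  if n is m.+1 then cup 1 (fun s => c s + coboundary (b m) s) (twisted_pow c b m)
  else fun=> 1.

Lemma coboundary_cup_nerve (T : topologicalType) (I : Type) (U : I -> set T)
    (p q : nat) (c d : seq I -> 'F_2) s :
  nerve U (p + q).+1 s ->
  coboundary (cup p c d) s = cup p.+1 (coboundary c) d s + cup p c (coboundary d) s.
Proof. by move=> [/(coboundary_cup c d) ]. Qed.

(** Induction on [n]: if [p] and [q] are the two products of degree [n], those of the next degree
    differ by [delta (b n) * p + e * (p - q)] with [e = c + delta (b n)]. The first term is the
    coboundary of [b n] cup [p] because [p] is a cocycle; the second is exact by induction because
    [e] is a cocycle. *)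
Lemma is_coboundary_twisted_pow (T : topologicalType) (I : Type) (U : I -> set T)
    (c : seq I -> 'F_2) (b : nat -> seq I -> 'F_2) (n : nat) :
  cocycle U 1 c -> is_coboundary U n (fun s => cup_pow c n s + twisted_pow c b n s).
Proof.
move=> cc; elim: n => [|n IH]; first by move=> s _; rewrite /= F2_addxx.
pose e s := c s + coboundary (b n) s.
have ce : cocycle U 1 e by apply: cocycle_add => //; exact: cocycle_coboundary0.
have cn := @cocycle_cup_pow _ _ U c n cc.
have [be dbe] : exists be, forall s, nerve U n.+1 s ->
    coboundary be s = coboundary (b n) (take 2 s) * cup_pow c n (drop 1 s).
  exists (cup 0 (b n) (cup_pow c n)) => s ns.
  rewrite (@coboundary_cup_nerve _ _ U 0 n)// /cup drop0.
  by rewrite [coboundary (cup_pow c n) _]cn// mulr0 addr0.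
have split s : cup_pow c n.+1 s + twisted_pow c b n.+1 s =
    coboundary (b n) (take 2 s) * cup_pow c n (drop 1 s) +
    e (take 2 s) * (cup_pow c n (drop 1 s) + twisted_pow c b n (drop 1 s)).
  rewrite /= /cup /e; set x := c _; set y := coboundary _ _.
  set p := cup_pow _ _ _; set q := twisted_pow _ _ _ _.
  (* [ring] does not use characteristic 2, so the cancelling term is first added twice. *)
  by have := F2_addxx (y * p) => yp; rewrite -[LHS]addr0 -yp; ring.
(* In degree 0 exactness means vanishing: the induction hypothesis then kills the second term
   instead of providing a cochain to cup with. *)
case: n => [|n] in IH e ce cn be dbe split *.
  exists be => s ns; rewrite split (dbe _ ns) IH ?mulr0 ?addr0//.
  exact: (@nerve_drop _ _ U 1 0).
have [a aP] := IH.
exists (fun s => be s + cup 1 e a s) => s ns.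
rewrite [RHS]big_split/= -/(coboundary be s) -/(coboundary (cup 1 e a) s).
rewrite split dbe//; congr (_ + _); rewrite (@coboundary_cup_nerve _ _ U 1 n)// /cup.
rewrite ce ?mul0r ?add0r; last exact: (@nerve_take _ _ U n.+2 2).
by rewrite aP//; exact: (@nerve_drop _ _ U 1 n.+1).
Qed.

(** On the edge of [s] where the factor of index [k] is evaluated, that factor is [c] plus a copy of
    [c], hence zero. The index may depend on [x]: different simplices can be killed by different
    factors. *)
Lemma twisted_pow_eq0 (T : topologicalType) (I : Type) (U : I -> set T)
    (c : seq I -> 'F_2) (b : nat -> seq I -> 'F_2) (n k : nat) (x : T) (s : seq I) :
  (k < n)%N ->
  (forall i j, U i x -> U j x -> c [:: i; j] = b k [:: i] + b k [:: j]) ->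
  size s = n.+1 -> (\big[setI/setT]_(i <- s) U i) x ->
  twisted_pow c b n s = 0.
Proof.
elim: n s => // n IH [|i [|j s]]//= kn cb [sz].
rewrite !big_cons => -[Ui [Uj Us]]; rewrite /cup /= ?take0 ?drop0.
move: kn; rewrite ltnS leq_eqVlt => /predU1P[kn|kn].
  by rewrite coboundary_pair -kn cb// [X in _ + X]addrC F2_addxx mul0r.
by rewrite IH ?mulr0//= ?sz// big_cons.
Qed.

(** * Connectedness of the infinite sphere, invariant distances *)

Lemma locally_constant_real (R : realType) (V : Type) (f : R -> V) :
  (forall t, \forall u \near t, f u = f t) -> forall t u, f t = f u.
Proof.
move=> fl t u.
have /connected_intervalP cT : is_interval [set: R] by [].
suff : [set v | f v = f u] = [set: R] by move=> /seteqP[_ /(_ t)]; exact.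
apply: cT; first by exists u.
- exists [set v | f v = f u]; last by rewrite setTI.
  by rewrite openE => v /= <-; exact: fl.
- exists [set v | f v = f u]; last by rewrite setTI.
  rewrite -openC openE => v /= fv; apply: filterS (fl v) => v' /= ->; exact: fv.
Qed.

Section Sphere.
Variable R : realType.

(** The basis vector of index [m] is orthogonal to [z], so the circle through both lies on the
    sphere; [a] and [b] are its rational parametrization, at [z] for [t = 0] and at the basis vector
    for [t = 1]. *)
Lemma sphere_path (z : EZ2 R) (m : nat) :
  (forall k, (m <= k)%N -> set_val z k = 0) ->
  exists g : R -> EZ2 R, continuous g /\ g 0 = z /\
    forall k, set_val (g 1) k = (k == m)%:R.
Proof.
move=> zm.
pose a (t : R) := (1 - t ^+ 2) / (1 + t ^+ 2).
pose b (t : R) := t *+ 2 / (1 + t ^+ 2).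
have d0 (t : R) : 1 + t ^+ 2 != 0 by rewrite gt_eqF// ltr_pwDl// sqr_ge0.
have ab t : a t ^+ 2 + b t ^+ 2 = 1.
  by rewrite /a /b; field; rewrite d0.
pose h t k := a t * set_val z k + b t * (k == m)%:R.
have hS t : h t \in @sphere_inf R.
  rewrite inE; exists m.+1; split=> [k mk|].
    by rewrite /h zm 1?ltnW// gtn_eqF// !mulr0 addr0.
  rewrite big_ord_recr /= /h zm// eqxx mulr0 add0r mulr1.
  rewrite -(ab t); congr (_ + _).
  have [m' [zm' z1]] := set_valP z.
  rewrite (eq_bigr (fun k : 'I_m => a t ^+ 2 * set_val z k ^+ 2)); last first.
    by move=> k _; rewrite ltn_eqF// mulr0 addr0 exprMn.
  rewrite -mulr_sumr -[RHS]mulr1 -z1; congr (_ * _).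
  (* The bound [m'] that comes with [z] may differ from [m], but the extra squares are zero. *)
  have wide p q : (forall k, (q <= k)%N -> set_val z k = 0) -> (q <= p)%N ->
      \sum_(k < p) set_val z k ^+ 2 = \sum_(k < q) set_val z k ^+ 2.
    move=> zq /subnK <-; rewrite addnC big_split_ord/= [X in _ + X]big1 ?addr0// => k _.
    by rewrite zq ?expr0n// leq_addr.
  by case: (leqP m m') => [|/ltnW] mm; [rewrite [RHS](wide _ m)|rewrite (wide _ m')].
exists (fun t => SigSub (hS t)); split; last first.
  split.
    apply/val_inj/funext => k /=; rewrite /h /a /b expr0n/=.
    by rewrite mul0rn !mul0r addr0 subr0 addr0 divr1 mul1r.
  move=> k; rewrite -[LHS]/(h 1 k) /h /a /b expr1n subrr !mul0r add0r.
  by rewrite -[1 + 1]/(2%:R) divff ?mul1r// pnatr_eq0.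
apply: continuous_comp_initial => t.
have FF : Filter ((set_val \o (fun t => SigSub (hS t) : EZ2 R)) @ nbhs t).
  exact: fmap_filter.
apply/cvg_sup => k A [_ [[W oW <-] /= Wx] WA].
apply: filterS WA _.
have csq (u : R) : v ^+ 2 @[v --> u] --> u ^+ 2.
  by rewrite expr2; apply: cvgM; exact: cvg_id.
have ch : continuous (h^~ k).
  move=> u; rewrite /h /a /b; apply: cvgD; apply: cvgM; try exact: cvg_cst.
    apply: cvgM.
      by apply: cvgB; [exact: cvg_cst|exact: csq].
    apply: cvgV => //; apply: cvgD; [exact: cvg_cst|exact: csq].
  apply: cvgM; first by apply: cvgMn; exact: cvg_id.
  apply: cvgV => //; apply: cvgD; [exact: cvg_cst|exact: csq].
have P := ch t _ (open_nbhs_nbhs (conj oW Wx)).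
by apply P.
Qed.

(** Any two points vanish beyond a common index, so paths join both to the same basis vector. *)
Lemma locally_constant_sphere (V : Type) (f : EZ2 R -> V) :
  (forall z, \forall y \near z, f y = f z) -> forall z z', f z = f z'.
Proof.
move=> fl z z'.
have [m [zm _]] := set_valP z; have [m' [zm' _]] := set_valP z'.
have [g [cg [g0 g1]]] := @sphere_path z (maxn m m') (fun k mk =>
  zm k (leq_trans (leq_maxl _ _) mk)).
have [g' [cg' [g'0 g'1]]] := @sphere_path z' (maxn m m') (fun k mk =>
  zm' k (leq_trans (leq_maxr _ _) mk)).
have E : g 1 = g' 1 by apply/val_inj/funext => k; rewrite [LHS]g1 [RHS]g'1.
have along (p : R -> EZ2 R) : continuous p -> f (p 0) = f (p 1).
  move=> cp; apply: (@locally_constant_real R V (f \o p)) => t.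
  exact: (cp t _ (fl (p t))).
by rewrite -g0 -g'0 (along g)// (along g')// E.
Qed.

End Sphere.

Lemma setdist_exists (R : realType) (X : metricType R) (A : set X) :
  closed A -> exists d : X -> R,
    continuous d /\ (forall x, 0 <= d x) /\ forall x, d x = 0 <-> A x.
Proof.
move=> cA; have [A0|/set0P[a0 Aa0]] := eqVneq A set0.
  (* The infimum of an empty set of distances is 0 by default, whereas here [d] must have no
     zero. *)
  exists (fun=> 1); split; first by move=> x; exact: cvg_cst.
  by split=> // x; rewrite A0; split=> // /eqP; rewrite oner_eq0.
pose E x := [set mdist x a | a in A].
have lbE x : lbound (E x) 0 by move=> _ [a _ <-]; exact: mdist_ge0.
have E0 x : E x !=set0 by exists (mdist x a0); exists a0.
have hlbE x : has_lbound (E x) by exists 0.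
have d_lip x y : inf (E x) <= mdist x y + inf (E y).
  rewrite -lerBlDl; apply: lb_le_inf => // _ [a Aa <-]; rewrite lerBlDl.
  by apply: le_trans (metric_triangle x y a); apply: ge_inf => //; exists a.
exists (fun x => inf (E x)); split; last split.
- move=> x; apply/(@cvgrPdist_lt R R^o) => e e0.
  apply/metricType_numDomainType.nbhs_mdistP; exists e => //= y xy.
  rewrite ltr_norml; apply/andP; split.
    rewrite ltrNl opprB ltrBlDr; apply: le_lt_trans (d_lip y x) _.
    by rewrite metric_sym ltrD2r.
  rewrite ltrBlDr; apply: le_lt_trans (d_lip x y) _.
  by rewrite ltrD2r.
- by move=> x; exact: lb_le_inf.
- move=> x; split=> [d0|Ax]; last first.
    apply/eqP; rewrite eq_le lb_le_inf// andbT.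
    by rewrite -[leRHS](mdistxx x); apply: ge_inf => //; exists x.
  apply: cA => B /metricType_numDomainType.nbhs_mdistP[e /= e0 Be].
  have [|_ [a Aa <-] xa] := @inf_lt _ (E x) e (E0 x); first by rewrite d0.
  by exists a; split=> //; exact: Be.
Qed.

(** * Invariant closed shrinkings of finite open covers *)

Section Shrinking.
Variables (R : realType) (X : metricType R) (sigma : X -> X).
Hypotheses (sigma_cont : continuous sigma) (sigmaK : involutive sigma).

(** The sum of the distances of [x] and [sigma x] to [A] is invariant; the terms being nonnegative,
    it vanishes only where both do. *)
Lemma invariant_setdist (A : set X) :
  closed A -> (forall x, A x -> A (sigma x)) ->
  exists d : X -> R, [/\ continuous d, (forall x, 0 <= d x),
    (forall x, d (sigma x) = d x) & forall x, d x = 0 <-> A x].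
Proof.
move=> /setdist_exists[d [cd [d0 dA]]] invA.
exists (fun x => d x + d (sigma x)); split.
- move=> x; apply: cvgD; first exact: cd.
  by apply: continuous_comp; [exact: sigma_cont|exact: cd].
- by move=> x; rewrite addr_ge0.
- by move=> x; rewrite sigmaK addrC.
- move=> x; split=> [/eqP|Ax].
    by rewrite paddr_eq0// => /andP[/eqP/dA].
  by rewrite (dA x).2// (dA (sigma x)).2 ?addr0//; exact: invA.
Qed.

(** [F i] is the set where the invariant distance to the complement of [O i] is the largest among
    all indices. A maximum exists by finiteness, and it is positive because the [O i] cover. *)
Lemma invariant_shrinking (I : finType) (O : I -> set X) :
  (forall i, open (O i)) -> (forall i x, O i x -> O i (sigma x)) ->
  (forall x, exists i, O i x) ->
  exists F : I -> set X, [/\ forall i, closed (F i),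
    forall i x, F i (sigma x) <-> F i x, forall i x, F i x -> O i x &
    forall x, exists i, F i x].
Proof.
move=> oO invO covO.
have /choice[d dP] i : exists d : X -> R, [/\ continuous d, (forall x, 0 <= d x),
    (forall x, d (sigma x) = d x) & forall x, d x = 0 <-> (~` O i) x].
  apply: invariant_setdist; first by rewrite closedC.
  by move=> x nO /invO; rewrite sigmaK.
have dgt0 i x : O i x -> 0 < d i x.
  have [_ d0 _ dO] := dP i => Ox; rewrite lt_neqAle d0 andbT eq_sym.
  by apply/eqP => /dO.
exists (fun i => [set x | forall j, d j x <= d i x]); split.
- move=> i; rewrite [X in closed X](_ : _ = \bigcap_(j in setT)
      ((fun x => d i x - d j x) @^-1` [set y | 0 <= y])); last first.
    apply/seteqP; split=> [x xi j _|x xi j]; first by rewrite /= subr_ge0; exact: xi.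
    by rewrite -subr_ge0; exact: xi.
  apply: closed_bigI => j _; apply: preimage_closed; last exact: closed_ge.
  move=> x _.
  have [ci _ _ _] := dP i; have [cj _ _ _] := dP j.
  by apply: cvgB; [exact: ci|exact: cj].
- move=> i x; have [_ _ di _] := dP i.
  by split=> /= xi j; have := xi j; have [_ _ dj _] := dP j; rewrite di dj.
- move=> i x /= xi; have [_ _ _ dO] := dP i; apply: contrapT => /dO di0.
  by have [j /dgt0] := covO x; rewrite ltNge -di0 xi.
- move=> x; have [i0 _] := covO x.
  exists [arg max_(i > i0) d i x]%O => j /=.
  by case: arg_maxP => // i _; apply.
Qed.

End Shrinking.

(** * Trivializations of a degree one class *)

(* [g i] reads a section of the double cover of [T] classified by [a], pulled
   back along [f], in the local chart over the [i]-th set of the cover. *)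
Definition trivialization (S T : topologicalType) (a : cech_class T 1)
    (f : S -> T) (g : cidx (cech_cover a) -> S -> 'F_2) : Prop :=
  (forall i y, cech_cover a i (f y) -> \forall y' \near y, g i y' = g i y) /\
  (forall i j y, cech_cover a i (f y) -> cech_cover a j (f y) ->
     g i y + g j y = cech_cochain (c := a) [:: i; j]).

Lemma trivialization_comp (S' S T : topologicalType) (a : cech_class T 1)
    (h : S' -> S) (f : S -> T) g :
  continuous h -> trivialization (a := a) f g ->
  trivialization (a := a) (f \o h) (fun i y => g i (h y)).
Proof.
move=> ch [gl ga]; split=> [i y Wi|i j y Wi Wj]; last exact: ga.
exact: (ch y _ (gl i _ Wi)).
Qed.

(** A primitive [b] of the pulled back cocycle on a refinement [V] gives the section: its value at
    [y] in the chart [i] is [b] at a member of [V] containing [y], corrected by the transition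
    between the two charts. *)
Lemma cech_zero_trivialization (S T : topologicalType) (f : S -> T)
    (cf : continuous f) (a : cech_class T 1) :
  cech_zero (cech_pow (cech_pullback cf a) 1) -> exists g, trivialization (a := a) f g.
Proof.
case=> V [tau [/= ref [b bP]]].
have /choice[v vP] := @cset_cover S V.
pose c := cech_cochain (c := a).
exists (fun i y => b [:: v y] + c [:: i; tau (v y)]).
(* Every member of [V] containing [y] gives the same value, so the arbitrary choice [v] does not
   spoil local constancy. *)
have gE i y k : cech_cover a i (f y) -> V k y ->
    b [:: v y] + c [:: i; tau (v y)] = b [:: k] + c [:: i; tau k].
  move=> Wi Vk; apply: F2_add_eq0.
  have /= := bP [:: v y; k].
  rewrite coboundary_pair /cup /= mulr1 => /(_ _)/wrap[].
    by split=> //; exists y; rewrite !big_cons big_nil; split=> //; split.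
  have := cocycle_triple (@cech_cocycle _ _ a) Wi (ref _ _ (vP y)) (ref _ _ Vk).
  rewrite -/c => + /= E; rewrite E => <-; ring.
split=> [i y Wi|i j y Wi Wj]; last first.
  apply: F2_add_eq0; have := cocycle_triple (@cech_cocycle _ _ a) Wi Wj (ref _ _ (vP y)).
  rewrite -/c => E; rewrite -[RHS]addr0 -{1}E -(F2_addxx (b [:: v y])); ring.
have oV := open_nbhs_nbhs (conj (@cset_open S V (v y)) (vP y)).
have oW := cf y _ (open_nbhs_nbhs (conj (@cset_open T _ i) Wi)).
apply: filterS2 oV oW => y' Vy' Wy'; exact: gE.
Qed.

(** Splitting each chart according to the value of its section refines the cover, and the recorded
    value is a 0-cochain whose coboundary is [a]. *)
Lemma trivialization_cech_zero (T : topologicalType) (a : cech_class T 1) g :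
  trivialization (a := a) id g -> cech_zero a.
Proof.
move=> [gl ga].
pose U (k : cidx (cech_cover a) * 'F_2) := [set y | cech_cover a k.1 y /\ g k.1 y = k.2].
have oU k : open (U k).
  rewrite openE => y [/= Wy gy].
  have oW := open_nbhs_nbhs (conj (@cset_open T _ k.1) Wy).
  by apply: filterS2 oW (gl _ _ Wy) => y' Wy' gy'; split=> //=; rewrite gy'.
have cU y : exists k, U k y.
  by have [i Wi] := @cset_cover T (cech_cover a) y; exists (i, g i y).
exists (OpenCover oU cU), fst; split; first by move=> k y [].
exists (fun s => if s is k :: _ then k.2 else 0) => s [].
case: s => [|k [|l [|]]]//= _ [y]; rewrite !big_cons => -[[/= Wk gk] [[/= Wl gl'] _]].
by rewrite coboundary_pair -gk -gl' addrC ga.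
Qed.

(** * Trivializations over the sphere and the Borel construction *)

Section Borel.
Variables (R : realType) (w : cech_class (RPinf R) 1).
Local Open Scope quotient_scope.

Lemma pi_orbit (Y : Z2space) : continuous (\pi_(orbit_space Y) : Y -> orbit_space Y).
Proof. exact: pi_continuous. Qed.

Lemma pi_act (Y : Z2space) (x : Y) :
  \pi_(orbit_space Y) (z2_act x) = \pi_(orbit_space Y) x.
Proof.
by apply/(@eqmodP _ (orbit_equiv Y)); rewrite /= /same_orbit z2_actK eqxx orbT.
Qed.

Lemma repr_pi (Y : Z2space) (x : Y) :
  repr (\pi_(orbit_space Y) x) = x \/ repr (\pi_(orbit_space Y) x) = z2_act x.
Proof.
have /(@eqmodP _ (orbit_equiv Y)) := reprK (\pi_(orbit_space Y) x).
rewrite /= /same_orbit => /orP[/eqP xE|/eqP xE]; [by left|right].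
by rewrite -[X in _ = z2_act X]xE z2_actK.
Qed.

(** Although [repr] is an arbitrary choice, invariance makes [P] the exact preimage of this set
    under the quotient map. *)
Lemma open_orbit (Y : Z2space) (P : set Y) :
  open P -> (forall x, P x -> P (z2_act x)) ->
  open [set q : orbit_space Y | P (repr q)].
Proof.
move=> oP invP; rewrite /open/= /quotient_open.
rewrite [X in open X](_ : _ = P)//; apply/seteqP; split=> x /=.
  by case: (repr_pi x) => -> // /invP; rewrite z2_actK.
by case: (repr_pi x) => -> // /invP.
Qed.

Lemma Borel_projE (Y : Z2space) (x : Y) (z : EZ2 R) :
  Borel_proj (\pi_(Borel R Y) (x, z)) = \pi_(RPinf R) z.
Proof.
rewrite /Borel_proj /orbit_map; case: (repr_pi (Y := prodZ2space Y (EZ2 R)) (x, z)) => -> //=.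
exact: pi_act.
Qed.

Lemma pair_left_continuous (A B : topologicalType) (a : A) :
  continuous (fun b : B => (a, b)).
Proof. by move=> b; apply: cvg_pair; [exact: cvg_cst|exact: cvg_id]. Qed.

Lemma pair_right_continuous (A B : topologicalType) (b : B) :
  continuous (fun a : A => (a, b)).
Proof. by move=> a; apply: cvg_pair; [exact: cvg_id|exact: cvg_cst]. Qed.

Lemma EZ2_nonempty : [set: EZ2 R] !=set0.
Proof.
have z0 : (fun k => (k == 0%N)%:R) \in @sphere_inf R.
  rewrite inE; exists 1%N; split=> [[|k]//|].
  by rewrite big_ord1 expr1n.
by exists (SigSub z0).
Qed.

Lemma Borel_trivialization (Y : Z2space) : cech_zero (w_pow w Y 1) ->
  exists G : cidx (cech_cover w) -> prodZ2space Y (EZ2 R) -> 'F_2,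
    trivialization (a := w) (fun p => \pi_(RPinf R) p.2) G /\
    forall i p, G i (z2_act p) = G i p.
Proof.
move=> /cech_zero_trivialization[G GP].
exists (fun i p => G i (\pi_(Borel R Y) p)); split; last first.
  by move=> i p; rewrite (@pi_act (prodZ2space Y (EZ2 R))).
have := trivialization_comp (@pi_orbit (prodZ2space Y (EZ2 R))) GP.
rewrite [X in trivialization X](_ : _ = fun p => \pi_(RPinf R) p.2)//.
by apply/funext => -[x z]; rewrite /= Borel_projE.
Qed.

(** This identifies the antipodal double cover of RP^oo with the one classified by [w]: in each
    chart, antipodal points get different values. *)
Definition odd_trivialization (g : cidx (cech_cover w) -> EZ2 R -> 'F_2) : Prop :=
  trivialization (a := w) (\pi_(RPinf R) : EZ2 R -> RPinf R) g /\
  forall i z, cech_cover w i (\pi_(RPinf R) z) -> g i (z2_act z) = g i z + 1.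

Lemma cech_cover_near (S : topologicalType) (h : S -> RPinf R) i y :
  continuous h -> cech_cover w i (h y) -> \forall y' \near y, cech_cover w i (h y').
Proof.
by move=> ch Wi; exact: (ch y _ (open_nbhs_nbhs (conj (@cset_open _ _ i) Wi))).
Qed.

(* Along the connected sphere, [g i z + g i (- z)] is constant.  If it were [0],
   the trivialization would descend to RP^oo and [w] would be zero. *)
Lemma odd_trivialization_exists (Y : Z2space) (x : Y) :
  is_generator w -> cech_zero (w_pow w Y 1) -> exists g, odd_trivialization g.
Proof.
move=> wN0 /Borel_trivialization[G [GP _]].
pose g i z := G i (x, z).
have gP : trivialization (a := w) (\pi_(RPinf R) : EZ2 R -> RPinf R) g.
  have cx : continuous (fun z : EZ2 R => (x, z) : prodZ2space Y (EZ2 R)).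
    exact: pair_left_continuous.
  exact: (trivialization_comp cx GP).
have [gl ga] := gP.
have /choice[i iP] : forall z : EZ2 R, exists i, cech_cover w i (\pi_(RPinf R) z).
  by move=> z; exact: cset_cover.
pose e z := g (i z) z + g (i z) (z2_act z).
(* A change of chart adds the same transition value at both antipodes, as they lie in one orbit; so
   [e] does not depend on the chart. *)
have eE j z : cech_cover w j (\pi_(RPinf R) z) -> e z = g j z + g j (z2_act z).
  move=> Wj; have Wj' := Wj; have Wi' := iP z; rewrite -pi_act in Wj' Wi'.
  apply: F2_add_eq0; rewrite /e addrACA (ga _ _ _ (iP z) Wj) (ga _ _ _ Wi' Wj').
  exact: F2_addxx.
have el z : \forall y \near z, e y = e z.
  have nW := cech_cover_near (@pi_orbit (EZ2 R)) (iP z).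
  have nz := gl _ _ (iP z).
  have Wz' := iP z; rewrite -pi_act in Wz'.
  have nz' : \forall y \near z, g (i z) (z2_act y) = g (i z) (z2_act z).
    exact: (@z2_act_continuous (EZ2 R) z _ (gl _ _ Wz')).
  apply: filterS3 nW nz nz' => y Wy gy gy'.
  by rewrite (eE (i z))// gy gy'.
have econst := locally_constant_sphere el.
exists g; split=> // j z Wj; apply: F2_add_eq0.
have [e0|/F2_eq1 e1] := eqVneq (e z) 0; last first.
  by rewrite addrA [g j _ + _]addrC -eE// e1 F2_addxx.
case: wN0; apply: (@trivialization_cech_zero _ w (fun k q => g k (repr q))).
split=> [k q Wk|k l q Wk Wl]; last by apply: ga; rewrite reprK.
pose P := [set y : EZ2 R | cech_cover w k (\pi_(RPinf R) y) /\ g k y = g k (repr q)].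
have oP : open P.
  rewrite openE => y [Wy gy].
  apply: filterS2 (cech_cover_near (@pi_orbit (EZ2 R)) Wy) (gl _ _ Wy) => y' Wy' gy'.
  by split=> //; rewrite gy'.
have iP' y : P y -> P (z2_act y).
  move=> [Wy gy]; split; first by rewrite pi_act.
  by rewrite -gy; apply/esym/F2_add_eq0; rewrite -eE// (econst y z).
have oQ := open_orbit oP iP'.
have Pq : P (repr q) by split=> //; rewrite reprK.
by apply: filterS (open_nbhs_nbhs (conj oQ Pq)) => q' [].
Qed.

(** On the product of [Y] with the sphere, [w] is trivialized both by [G], from the Borel
    construction, and by [g]. Their difference is independent of the chart and locally constant,
    hence constant along the connected sphere; it is odd because [G] is invariant and [g] is odd. *)
Lemma odd_map_exists (Y : Z2space) g :
  odd_trivialization g -> cech_zero (w_pow w Y 1) ->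
  exists f : Y -> 'F_2, (forall x, \forall y \near x, f y = f x) /\
    forall x, f (z2_act x) = f x + 1.
Proof.
move=> [[gl ga] go] /Borel_trivialization[G [[Gl Ga] Gi]].
have /choice[i iP] : forall z : EZ2 R, exists i, cech_cover w i (\pi_(RPinf R) z).
  by move=> z; exact: cset_cover.
pose F (p : prodZ2space Y (EZ2 R)) := G (i p.2) p + g (i p.2) p.2.
have FE j p : cech_cover w j (\pi_(RPinf R) p.2) -> F p = G j p + g j p.2.
  move=> Wj; apply: F2_add_eq0; rewrite /F addrACA Ga// ga//; exact: F2_addxx.
have cpi : continuous (fun p : prodZ2space Y (EZ2 R) => \pi_(RPinf R) p.2).
  by move=> p; apply: continuous_comp; [exact: cvg_snd|exact: pi_orbit].
have Fl p : \forall q \near p, F q = F p.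
  have nW := cech_cover_near cpi (iP p.2).
  have ng : \forall q \near p, g (i p.2) q.2 = g (i p.2) p.2.
    case: p {nW} => x z; exact: (cvg_snd (gl _ _ (iP z))).
  apply: filterS3 nW (Gl _ _ (iP p.2)) ng => q Wq Gq gq.
  by rewrite (FE (i p.2))// Gq gq.
have Fc x z z' : F (x, z) = F (x, z').
  apply: (@locally_constant_sphere R _ (fun z => F (x, z))) => {}z.
  have cx : (fun z : EZ2 R => (x, z) : prodZ2space Y (EZ2 R)) @ z --> (x, z).
    exact: pair_left_continuous.
  exact: (cx _ (Fl (x, z))).
have [z _] := EZ2_nonempty.
exists (fun x => F (x, z)); split=> x.
  have cz : (fun x : Y => (x, z) : prodZ2space Y (EZ2 R)) @ x --> (x, z).
    exact: pair_right_continuous.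
  exact: (cz _ (Fl (x, z))).
have Wz := iP z; rewrite -pi_act in Wz.
(* Constancy along the sphere moves [(z2_act x, z)] to [(z2_act x, z2_act z)], the image of [(x, z)]
   under the diagonal action. *)
rewrite (Fc _ z (z2_act z)) (FE (i z) (z2_act x, z2_act z) Wz).
by rewrite (go _ _ (iP z)) (Gi (i z) (x, z)) addrA.
Qed.

End Borel.

(** * Vanishing of the cup power *)

Lemma cup_pow_map (I J : Type) (t : J -> I) (c : seq I -> 'F_2) n s :
  cup_pow c n (map t s) = cup_pow (fun s => c (map t s)) n s.
Proof.
by elim: n s => // n IH s; rewrite /= /cup map_take -IH map_drop.
Qed.

Lemma nerve_map (T : topologicalType) (I J : Type) (U : I -> set T) (V : J -> set T)
    (t : J -> I) n s :
  (forall j, V j `<=` U (t j)) -> nerve V n s -> nerve U n (map t s).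
Proof.
move=> VU [sz [x Vx]]; split; first by rewrite size_map.
by exists x; move: Vx {sz}; elim: s => [|j s IH]; rewrite ?big_nil ?big_cons// => -[/VU ? /IH].
Qed.

Lemma cocycle_map (T : topologicalType) (I J : Type) (U : I -> set T) (V : J -> set T)
    (t : J -> I) n c :
  (forall j, V j `<=` U (t j)) -> cocycle U n c -> cocycle V n (fun s => c (map t s)).
Proof.
move=> VU cc s ns; rewrite -[RHS](cc _ (nerve_map VU ns)) /coboundary size_map.
by apply: eq_bigr => k _; rewrite /face map_cat map_take map_drop.
Qed.

(* Sets of one colour behave as one open set carrying one odd map, so [X] is
   covered by [n] open sets over which [w] vanishes.  A member of the cover of the
   Borel construction records the set [S] of the [O k] containing it and the local
   values of the [f k] there; since it meets no [F k] with [k] outside [S], the sets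
   [S] along a simplex have a common element. *)
Lemma cech_zero_coloured_cover (R : realType) (w : cech_class (RPinf R) 1) g
    (X : Z2space) (I : finType) (O F : I -> set X) (f : I -> X -> 'F_2)
    (col : I -> nat) (n : nat) :
  odd_trivialization (w := w) g ->
  (forall i, open (O i)) -> (forall i x, O i x -> O i (z2_act x)) ->
  (forall i, closed (F i)) -> (forall i x, F i (z2_act x) <-> F i x) ->
  (forall i, F i `<=` O i) -> (forall x, exists i, F i x) ->
  (forall i x, O i x -> \forall y \near x, f i y = f i x) ->
  (forall i x, O i x -> f i (z2_act x) = f i x + 1) ->
  (forall i x, O i x -> (col i < n)%N) ->
  (forall i j x, O i x -> O j x -> col i = col j -> i = j) ->
  cech_zero (w_pow w X n).
Proof.
move=> [[gl ga] go] oO invO cF invF FO covF fl fo coln colO.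
pose c := cech_cochain (c := w).
pose K : Type := (cidx (cech_cover w) * {set I} * (I -> 'F_2))%type.
pose P (k : K) := [set p : prodZ2space X (EZ2 R) |
  [/\ cech_cover w k.1.1 (\pi_(RPinf R) p.2)%qT,
      forall i, i \in k.1.2 -> O i p.1 /\ f i p.1 + g k.1.1 p.2 = k.2 i &
      forall i, i \notin k.1.2 -> ~ F i p.1]].
have cpi : continuous (fun p : prodZ2space X (EZ2 R) => (\pi_(RPinf R) p.2)%qT).
  by move=> p; apply: continuous_comp; [exact: cvg_snd|exact: pi_orbit].
have near1 (p : prodZ2space X (EZ2 R)) (A : set X) :
    nbhs p.1 A -> \forall q \near p, A q.1.
  by case: p => x z nA; exact: (cvg_fst nA).
have near2 (p : prodZ2space X (EZ2 R)) (A : set (EZ2 R)) :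
    nbhs p.2 A -> \forall q \near p, A q.2.
  by case: p => x z nA; exact: (cvg_snd nA).
have oP k : open (P k).
  rewrite openE => p [Wp Op Fp].
  have n1 := cech_cover_near cpi Wp.
  have n2 : \forall q \near p, forall i, i \in k.1.2 ->
      O i q.1 /\ f i q.1 + g k.1.1 q.2 = k.2 i.
    apply: (@filter_forall _ I (fun i q => i \in k.1.2 ->
      O i q.1 /\ f i q.1 + g k.1.1 q.2 = k.2 i) (nbhs p)) => i.
    have [iS|] := boolP (i \in k.1.2); last first.
      by move=> _; apply: nearW.
    have [Oi fi] := Op i iS.
    have m1 := near1 _ _ (open_nbhs_nbhs (conj (oO i) Oi)).
    have m2 := near1 _ _ (fl _ _ Oi).
    have m3 := near2 _ _ (gl _ _ Wp).
    by apply: filterS3 m1 m2 m3 => q Oq fq gq _; rewrite fq gq.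
  have n3 : \forall q \near p, forall i, i \notin k.1.2 -> ~ F i q.1.
    apply: (@filter_forall _ I (fun i q => i \notin k.1.2 -> ~ F i q.1) (nbhs p)) => i.
    have [iS|iS] := boolP (i \in k.1.2).
      by apply: nearW.
    have oF : open (~` F i) by rewrite openC.
    have m1 := near1 _ _ (open_nbhs_nbhs (conj oF (Fp i iS))).
    by apply: filterS m1 => q Fq.
  by apply: filterS3 n1 n2 n3 => q *; split.
(* Both [f i] and [g] change by 1 under the action, so their sum, unlike either term, can be
   recorded on the orbit space. *)
have invP k p : P k p -> P k (z2_act p).
  case: p => x z [Wp Op Fp]; have Wp' := Wp; rewrite -pi_act in Wp'.
  split=> //.
    move=> i iS; have [/= Oi <-] := Op i iS; split; first exact: invO.
    by rewrite (fo _ _ Oi) go// addrACA F2_addxx addr0.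
  by move=> i iS /invF; exact: Fp.
pose V k := [set q : Borel R X | P k (repr q)%qT].
have oV k : open (V k) by exact: open_orbit (oP k) (invP k).
have cV q : exists k, V k q.
  set p : prodZ2space X (EZ2 R) := repr q.
  have [j Wj] := @cset_cover _ (cech_cover w) (\pi_(RPinf R) p.2)%qT.
  (* The smallest admissible set of indices is taken: those with [p.1] in [F i]. *)
  exists (j, [set i | `[< F i p.1 >]]%SET, fun i => f i p.1 + g j p.2).
  split=> //= i; rewrite inE; first by move/asboolP/FO.
  by move/asboolP.
pose tau (k : K) := k.1.1.
have ref k : V k `<=` preimage_cover (@Borel_proj_continuous R X) (cech_cover w) (tau k).
  by move=> q [].
exists (OpenCover oV cV), tau; split; first exact: ref.
(* On a nonempty [V k] at most one recorded index has colour [m], by [colO]; 0 is a default when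
   there is none. *)
pose val m (k : K) := if [pick i in k.1.2 | col i == m] is Some i then k.2 i else 0.
pose b m (s : seq K) := if s is k :: _ then val m k else 0.
have valE k q i : V k q -> i \in k.1.2 ->
    val (col i) k = f i (repr q).1%qT + g k.1.1 (repr q).2%qT.
  move=> [Wq Oq _] iS; rewrite /val; case: pickP => [j /andP[jS /eqP ji]|/(_ i)].
    have [Oi _] := Oq _ iS; have [Oj <-] := Oq _ jS.
    by rewrite (colO _ _ _ Oj Oi ji).
  by rewrite iS eqxx.
have cc : cocycle V 1 (fun s => c (map tau s)).
  exact: cocycle_map ref (@cech_cocycle _ _ (cech_pullback (@Borel_proj_continuous R X) w)).
have tw0 s : nerve V n s -> twisted_pow (fun s => c (map tau s)) b n s = 0.
  move=> [sz [q Vq]].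
  (* This [i] is recorded by every vertex of the simplex; the values [f i] cancel in pairs and leave
     the transition of [g], which is [c]. *)
  have [i Fi] := covF (repr q).1%qT.
  apply: (twisted_pow_eq0 (k := col i) (x := q) (U := V)) => //.
    exact: coln (FO _ _ Fi).
  move=> k l Vk Vl.
  have inS m : V m q -> i \in m.1.2.
    by move=> [_ _ Fm]; apply/negPn/negP => /Fm; exact.
  rewrite /b (valE _ _ _ Vk (inS _ Vk)) (valE _ _ _ Vl (inS _ Vl)) addrACA F2_addxx add0r.
  by case: Vk => Wk _ _; case: Vl => Wl _ _; rewrite ga.
have := @is_coboundary_twisted_pow _ _ V _ b n cc.
have E s : nerve V n s -> cup_pow c n (map tau s) =
    cup_pow (fun s => c (map tau s)) n s + twisted_pow (fun s => c (map tau s)) b n s.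
  by move=> ns; rewrite tw0// addr0 cup_pow_map.
case: n {coln} E {tw0} => [E ib s ns|n E [a aP]].
  exact: etrans (E s ns) (ib s ns).
by exists a => s ns; exact: etrans (E s ns) (aP s ns).
Qed.

(** * From vanishing classes to anti-invariant real functions *)

Lemma cech_zero_empty (T : topologicalType) n (a : cech_class T n) :
  (T -> False) -> cech_zero a.
Proof.
move=> T0; exists (cech_cover a), id; split; first by move=> x.
case: n a => [|n] a; last exists (fun=> 0).
  by move=> s [_ [x _]]; case: (T0 x).
by move=> s [_ [x _]]; case: (T0 x).
Qed.

Lemma ind_cech_zero (R : realType) (w : cech_class (RPinf R) 1) (Y : Z2space) n m :
  ind w Y = Some n -> (n < m)%N -> cech_zero (w_pow w Y m).
Proof.
move=> /indP[_ nmax] nm; apply: contrapT => /nmax.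
by rewrite leqNgt nm.
Qed.

Lemma odd_map_closed (Y : Z2space) (U : set Y) (invU : z2_invariant U)
    (f : subZ2space invU -> 'F_2) :
  closed U -> (forall x, \forall y \near x, f y = f x) ->
  closed [set set_val x | x in [set x : U | f x = 0]].
Proof.
move=> cU fl x clx.
have Ux : U x.
  by apply: cU => B /clx[_ [[y _ <-] By]]; exists (set_val y); split=> //; exact: set_valP.
pose y : U := SigSub (mem_set Ux).
exists y => //=.
have [B [[C oC CB] By Bf]] := fl y.
have nC : nbhs x C by apply: open_nbhs_nbhs; split=> //; move: By; rewrite -CB.
have [_ [[y' /= fy' <-] Cy']] := clx _ nC.
have By' : B y' by rewrite -CB.
by rewrite -(Bf _ By').
Qed.

Section AntiInvariant.
Variables (R : realType) (X : metricType R) (sigma : X -> X).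
Hypotheses (sigma_cont : continuous sigma) (sigmaK : involutive sigma).
Local Notation Y := (MkZ2space sigma_cont sigmaK).

(** Let [d] be the distance to the fibre of [f] over 0, which is closed in [X]. For [x] in [U],
    exactly one of [x] and [sigma x] lies in that fibre, so [d (sigma x) - d x] is nonzero. *)
Lemma anti_invariant_function (U : set Y) (invU : z2_invariant U)
    (f : subZ2space invU -> 'F_2) :
  closed U -> (forall x, \forall y \near x, f y = f x) ->
  (forall x, f (z2_act x) = f x + 1) ->
  exists u : X -> R, [/\ continuous u, forall x, u (sigma x) = - u x &
    forall x, U x -> u x != 0].
Proof.
move=> cU fl fo; pose A : set X := [set set_val x | x in [set x : U | f x = 0]].
have [d [cd [d0 dA]]] := @setdist_exists R X A (odd_map_closed cU fl).
have AP (x : U) : A (set_val x) <-> f x = 0.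
  by split=> [[y /= fy /val_inj <-]//|fx]; exists x.
exists (fun x => d (sigma x) - d x); split.
- move=> x; apply: cvgB; last exact: cd.
  by apply: continuous_comp; [exact: sigma_cont|exact: cd].
- by move=> x; rewrite sigmaK opprB.
- move=> x Ux; pose y : subZ2space invU := SigSub (mem_set Ux).
  have xA : A x <-> f y = 0 := AP y.
  have sxA : A (sigma x) <-> f y + 1 = 0 by rewrite -fo; exact: (AP (z2_act y)).
  rewrite subr_eq0; apply/eqP => dE.
  have [fy|/F2_eq1 fy] := eqVneq (f y) 0.
    have dx := (dA x).2 (xA.2 fy); have /sxA := (dA (sigma x)).1 (etrans dE dx).
    by rewrite fy add0r => /eqP; rewrite oner_eq0.
  have dsx : d (sigma x) = 0 by apply/dA/sxA; rewrite fy F2_addxx.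
  have /xA := (dA x).1 (etrans (esym dE) dsx).
  by rewrite fy => /eqP; rewrite oner_eq0.
Qed.

End AntiInvariant.

Lemma exists_subset_card (T : finType) (A : {set T}) n :
  (n <= #|A|)%N -> exists J : {set T}, #|J| = n /\ J \subset A.
Proof.
move=> nA; exists [set x in take n (enum A)]%SET; split.
  by rewrite cardsE (card_uniqP _) ?take_uniq ?enum_uniq// size_takel// -cardE.
by apply/fintype.subsetP => x; rewrite inE => /mem_take; rewrite mem_enum.
Qed.

Theorem theorem3p11 (R : realType) (X : metricType R) (sigma : X -> X)
    (sigma_cont : continuous sigma) (sigmaK : involutive sigma)
    (w : cech_class (RPinf R) 1) (w_gen : is_generator w)
    (n N : nat) (U : 'I_N -> set (MkZ2space sigma_cont sigmaK)) :
  compact [set: X] ->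
  ind w (MkZ2space sigma_cont sigmaK) = Some n ->
  (forall i, closed (U i)) ->
  (forall i, inessential w (U i)) ->
  \bigcup_i U i = [set: X] ->
  (n.+1 <= N)%N /\
  exists J : {set 'I_N}, #|J| = n.+1 /\ exists x : X, forall i, i \in J -> U i x.
Proof.
move=> _ indX cU inU covU.
pose Tx (x : X) := [set i | `[< U i x >]]%SET.
have TxP i x : i \in Tx x <-> U i x by rewrite inE; split=> /asboolP.
have [[x nx]|few] := pselect (exists x : X, (n < #|Tx x|)%N).
  split; first by apply: leq_trans nx _; rewrite -[leqRHS]card_ord max_card.
  have [J [Jn /fintype.subsetP JT]] := exists_subset_card nx.
  by exists J; split=> //; exists x => i /JT/TxP.
(* Otherwise every point lies in at most [n] of the sets, and the [n]-th power of [w] is shown to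
   vanish, against [indX]. *)
have {}few x : (#|Tx x| <= n)%N by rewrite leqNgt; apply/negP => nx; apply: few; exists x.
have [wn _] := (indP _ _ _).1 indX; case: wn.
have [[x0 _]|X0] := pselect (exists x : X, True); last first.
  by apply: cech_zero_empty => q; apply: X0; exists (repr q).1%qT.
pose inv i := projT1 (cid (inU i)).
have invP i : cech_zero (w_pow w (subZ2space (inv i)) 1).
  exact: ind_cech_zero (projT2 (cid (inU i))) _.
have covx x : exists i, U i x.
  have : (\bigcup_i U i) x by rewrite covU.
  by case=> i _ Ui; exists i.
have [i0 U0] := covx x0.
have [g gP] := odd_trivialization_exists (SigSub (mem_set U0) : subZ2space (inv i0))
  w_gen (invP i0).
have /choice[u uP] i : exists u : X -> R, [/\ continuous u,
    forall x, u (sigma x) = - u x & forall x, U i x -> u x != 0].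
  have [f [fl fo]] := odd_map_exists gP (invP i).
  exact: anti_invariant_function (cU i) fl fo.
have sU i x : U i x -> U i (sigma x).
  by move=> Ux; have := inv i; rewrite /z2_invariant => <-; exists x.
have /choice[d dP] i := invariant_setdist sigma_cont sigmaK (cU i) (sU i).
pose O (T : {set 'I_N}) : set X := [set x | [/\ (0 < #|T| <= n)%N,
  forall i, i \in T -> u i x != 0 &
  forall i j, i \in T -> j \notin T -> d i x < d j x]].
(* The picked index depends on [T] alone, so on [O T] this is the sign of a single [u i]. The
   default 0 concerns only the empty [T], for which [O T] is empty. *)
pose f (T : {set 'I_N}) x : 'F_2 :=
  if [pick i in T] is Some i then ((u i x < 0)%R : nat)%:R else 0.
have opos (h : X -> R) : continuous h -> open [set x | 0 < h x].
  by move=> /continuousP ch; exact: (ch _ (@open_gt _ 0)).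
have oneg (h : X -> R) : continuous h -> open [set x | h x < 0].
  by move=> /continuousP ch; exact: (ch _ (@open_lt _ 0)).
have near_sign i x : u i x != 0 -> \forall y \near x, (u i y < 0) = (u i x < 0) /\ u i y != 0.
  have [cu _ _] := uP i; case: ltgtP => // ux _.
    apply: filterS (open_nbhs_nbhs (conj (oneg _ cu) ux)) => y /= uy.
    by rewrite uy lt_eqF.
  apply: filterS (open_nbhs_nbhs (conj (opos _ cu) ux)) => y /= uy.
  by rewrite ltNge (ltW uy) gt_eqF.
have oO T : open (O T).
  rewrite openE => x [T0 uT dT].
  have n1 : \forall y \near x, forall i, i \in T -> u i y != 0.
    apply: (@filter_forall _ _ (fun i y => i \in T -> u i y != 0) (nbhs x)) => i.
    have [iT|] := boolP (i \in T); last by move=> _; apply: nearW.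
    by apply: filterS (near_sign _ _ (uT i iT)) => y [].
  have n2 : \forall y \near x, forall p : 'I_N * 'I_N,
      p.1 \in T -> p.2 \notin T -> d p.1 y < d p.2 y.
    apply: (@filter_forall _ _ (fun p y => p.1 \in T -> p.2 \notin T ->
      d p.1 y < d p.2 y) (nbhs x)) => -[i j] /=.
    have [iT|] := boolP (i \in T); last by move=> _; apply: nearW.
    have [|jT] := boolP (j \in T); first by move=> _; apply: nearW.
    have [ci _ _ _] := dP i; have [cj _ _ _] := dP j.
    have cd : continuous (fun y => d j y - d i y).
      by move=> y; apply: cvgB; [exact: cj|exact: ci].
    have dx : 0 < d j x - d i x by rewrite subr_gt0 dT.
    apply: filterS (open_nbhs_nbhs (conj (opos _ cd) dx)) => y /=.
    by rewrite subr_gt0.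
  apply: filterS2 n1 n2 => y uy dy; split=> // i j iT jT.
  exact: (dy (i, j)).
have invO T x : O T x -> O T (sigma x).
  move=> [T0 uT dT]; split=> // [i iT|i j iT jT].
    by have [_ -> _] := uP i; rewrite oppr_eq0 uT.
  by have [_ _ -> _] := dP i; have [_ _ -> _] := dP j; exact: dT.
have covO x : exists T, O T x.
  exists (Tx x); split.
  - rewrite few andbT card_gt0; apply/set0Pn.
    by have [i Ui] := covx x; exists i; apply/TxP.
  - by move=> i /TxP; have [_ _] := uP i; exact.
  - move=> i j /TxP Ui jT; have [_ _ _ /(_ x) di] := dP i.
    have [_ dj0 _ /(_ x) dj] := dP j; rewrite di.2// lt_neqAle dj0 andbT eq_sym.
    by apply/eqP => /dj/TxP; apply/negP.
have [F [cF invF FO covF]] := invariant_shrinking sigma_cont sigmaK oO invO covO.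
have pickT T x : O T x -> exists2 i, i \in T & f T = fun y => ((u i y < 0)%R : nat)%:R.
  move=> [/andP[/card_gt0P[j jT] _] _ _]; rewrite /f.
  by case: pickP => [i iT|/(_ j)]; [exists i|rewrite jT].
(* If two sets of equal size were not nested, each would have an element outside the other, giving
   [d i x < d j x < d i x]. *)
have sizeO T T' x : O T x -> O T' x -> #|T| = #|T'| -> T \subset T'.
  move=> [_ _ dT] [_ _ dT'] TT'; apply/negPn/negP => nTT'.
  have /fintype.subsetPn[i iT iT'] := nTT'.
  have /fintype.subsetPn[j jT' jT] : ~~ (T' \subset T).
    by apply: contra nTT' => T'T; rewrite -(eqP (_ : T' == T)) // eqEcard T'T TT' leqnn.
  by have := lt_trans (dT _ _ iT jT) (dT' _ _ jT' iT'); rewrite ltxx.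
(* Sizes run from 1 to [n] while colours must be less than [n], hence the predecessor. *)
apply: (@cech_zero_coloured_cover R w g (MkZ2space sigma_cont sigmaK) _ O F f
  (fun T => #|T|.-1) n gP oO invO cF invF FO covF).
- move=> T x OT; have [i iT ->] := pickT _ _ OT; have [_ /(_ i iT) ui _] := OT.
  by apply: filterS (near_sign _ _ ui) => y [->].
- move=> T x OT; have [i iT ->] := pickT _ _ OT; have [_ /(_ i iT) ui _] := OT.
  rewrite /=; have [_ -> _] := uP i; rewrite oppr_lt0.
  by case: ltgtP ui => // _ _; rewrite ?add0r// F2_addxx.
- by move=> T x [/andP[T0 Tn] _ _]; rewrite prednK.
- move=> T T' x OT OT' TT'.
  have {}TT' : #|T| = #|T'|.
    have [/andP[T0 _] _ _] := OT; have [/andP[T'0 _] _ _] := OT'.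
    by rewrite -(prednK T0) TT' prednK.
  apply/eqP; rewrite finset.eqEsubset (sizeO _ _ _ OT OT' TT').
  exact: sizeO OT' OT (esym TT').
Qed.
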